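(* Let $(\Omega,\mathcal F,\mathbb P)$ be a nonatomic probability space, $0\le p<\infty$, $\alpha\in(0,1)$, and let $S=(S_0,S_T)$ be a traded asset with $S_T\in L^p_+$. The following statements are equivalent: (a) $\rho_{\mathcal A_\alpha,S}$ is finitely valued on $L^p$; (b) $\mathbb P(S_T=0)<\min\{\alpha,1-\alpha\}$. Moreover, $\rho_{\mathcal A_\alpha,S}$ is never globally continuous on $L^p$ (i.e. for no choice of the traded asset $S$ is $\rho_{\mathcal A_\alpha,S}$ continuous at every point of $L^p$).
   Context: $L^p=L^p(\Omega,\mathcal F,\mathbb P)$ carries its usual topology: convergence in probability for $p=0$, the metric $\mathbb E[|X-Y|^p]$ for $0<p<1$, the usual norm for $p\ge1$; order is almost sure pointwise order, with positive cone $L^p_+$. A traded asset is a pair $S=(S_0,S_T)$ with $S_0>0$ real and $S_T\in L^p_+$ nonzero. For $\alpha\in(0,1)$, $\operatorname{VaR}_\alpha(X)=\inf\{m\in\mathbb R : \mathbb P(X+m<0)\le\alpha\}$ and $\mathcal A_\alpha=\{X\in L^p : \operatorname{VaR}_\alpha(X)\le0\}=\{X\in L^p : \mathbb P(X<0)\le\alpha\}$. The risk measure $\rho_{\mathcal A_\alpha,S}:L^p\to\mathbb R\cup\{\pm\infty\}$ is $$\rho_{\mathcal A_\alpha,S}(X)=\inf\{m\in\mathbb R : \mathbb P(X+\tfrac{m}{S_0}S_T<0)\le\alpha\},\qquad \inf\emptyset=\infty.$$ A function $\rho:L^p\to\mathbb R\cup\{\pm\infty\}$ is lower semicontinuous at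 $X$ if for every $\varepsilon>0$ there is a neighborhood $\mathcal U$ of $X$ with $\rho(Y)\ge\rho(X)-\varepsilon$ for all $Y\in\mathcal U$, upper semicontinuous at $X$ if $-\rho$ is lower semicontinuous at $X$, and continuous at $X$ if both hold. *)

(* Defs.v *)
From HB Require Import structures.
From mathcomp Require Import all_boot all_order all_algebra.
From mathcomp Require Import all_classical all_reals all_analysis.
From mathcomp Require Import measurable_realfun.

Set Implicit Arguments.
Unset Strict Implicit.
Unset Printing Implicit Defensive.
Import Order.TTheory GRing.Theory Num.Theory.
Import numFieldNormedType.Exports.

Local Open Scope classical_set_scope.
Local Open Scope ring_scope.

Definition nonatomic d (T : measurableType d) (R : realType)
    (P : probability T R) : Prop :=
  forall A : set T, measurable A -> (0 < P A)%E ->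
    exists B : set T,
      [/\ measurable B, B `<=` A, (0 < P B)%E & (P B < P A)%E].

(* [LspaceType] requires [1 <= p]; this is the same space of almost-everywhere
   classes for every real [p >= 0]. An element is used as a function through the
   library's choice of a representative of its class. The power [`^ p] is not
   used for [p = 0], where every class is admitted. *)
Record LpType d (T : measurableType d) (R : realType) (P : probability T R)
    (p : R) (p0 : 0 <= p) := MkLp {
  Lp_class : {mfun_ P, T >-> measurableTypeR R} ;
  Lp_finite : (p == 0) || `[< finite_norm P p%:E Lp_class >] }.

Definition Lp_fun d (T : measurableType d) (R : realType) (P : probability T R)
  (p : R) (p0 : 0 <= p) (X : LpType P p0) : T -> R := Lp_class X.
Coercion Lp_fun : LpType >-> Funclass.

Section Lp_structure.
Context d (T : measurableType d) (R : realType) (P : probability T R).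
Variables (p : R) (p0 : 0 <= p).
Local Notation Lp := (LpType P p0).

HB.instance Definition _ := [isSub for @Lp_class d T R P p p0].
HB.instance Definition _ := [Choice of Lp by <:].

(* For [p = 0] these are the sets [P(|X - Y| >= e) < e], which form a basis of
   neighbourhoods of [X] for convergence in probability. *)
Definition Lp_ball (X : Lp) (e : R) (Y : Lp) : Prop :=
  if p == 0 then (P [set w | e <= `|X w - Y w|]%R < e%:E)%E
  else if p < 1 then (\int[P]_w (`|X w - Y w| `^ p)%:E < e%:E)%E
  else ('N[P]_p%:E [EFin \o (fun w => X w - Y w)%R] < e%:E)%E.

Let mX (X : Lp) : measurable_fun [set: T] X.
Proof. exact: (@measurable_funPT _ _ _ _ (repr (Lp_class X))). Qed.

Let mXB (X Y : Lp) : measurable_fun [set: T] (fun w => X w - Y w).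
Proof. exact: measurable_funB (mX X) (mX Y). Qed.

Let mset (X Y : Lp) (e : R) : measurable [set w | e <= `|X w - Y w|].
Proof.
have mf : measurable_fun setT (fun w => `|X w - Y w|).
  exact: measurableT_comp (mXB X Y).
rewrite (_ : [set w | _] = setT `&` (fun w => `|X w - Y w|) @^-1` `[e, +oo[).
  by apply: mf => //; exact: measurable_itv.
by rewrite setTI; apply/seteqP; split => w /=; rewrite in_itv/= andbT.
Qed.

Let ball_center (X : Lp) (e : R) : 0 < e -> Lp_ball X e X.
Proof.
move=> e0; rewrite /Lp_ball; case: ifPn => [_|pn0].
  rewrite (_ : [set w | _] = set0) ?measure0 ?lte_fin//.
  by apply/seteqP; split => // w /=; rewrite subrr normr0 leNgt e0.
case: ifPn => _.
  under eq_integral do rewrite subrr normr0 powR0//.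
  by rewrite integral0 lte_fin.
rewrite (_ : EFin \o _ = cst 0%E); last first.
  by apply/funext => w /=; rewrite subrr.
by rewrite Lnorm0 ?lte_fin// eqe.
Qed.

Let ball_sym (X Y : Lp) (e : R) : Lp_ball X e Y -> Lp_ball Y e X.
Proof.
rewrite /Lp_ball; case: ifPn => [_|pn0].
  by under eq_set do rewrite distrC.
case: ifPn => _; first by under eq_integral do rewrite distrC.
rewrite -oppe_Lnorm; congr (Lnorm _ _ _ < _)%E.
by apply/funext => w /=; rewrite opprB.
Qed.

Let powR_sub (a b : R) : 0 < p -> p < 1 -> 0 <= a -> 0 <= b ->
  (a + b) `^ p <= a `^ p + b `^ p.
Proof.
move=> pgt plt a0 b0; have [ab|abn] := eqVneq (a + b) 0.
  by rewrite ab powR0 ?gt_eqF// addr_ge0// powR_ge0.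
have ab0 : 0 < a + b by rewrite lt_neqAle eq_sym abn addr_ge0.
have key c : 0 <= c -> c <= a + b -> c / (a + b) * (a + b) `^ p <= c `^ p.
  move=> c0 cab; have [->|cn] := eqVneq c 0; first by rewrite !mul0r powR_ge0.
  rewrite -[in leRHS](divfK abn c) powRM ?divr_ge0// ?(ltW ab0)//.
  rewrite ler_wpM2r ?powR_ge0// ger1_powR ?(ltW plt)//.
  by rewrite divr_gt0//= ?ler_pdivrMr ?mul1r// lt_neqAle eq_sym cn.
rewrite -[leLHS]mul1r -(divff abn) mulrDl mulrDl.
by rewrite lerD// key// ?lerDl ?lerDr.
Qed.

Let ball_triangle (X Y Z : Lp) (e1 e2 : R) :
  Lp_ball X e1 Y -> Lp_ball Y e2 Z -> Lp_ball X (e1 + e2) Z.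
Proof.
rewrite /Lp_ball; case: ifPn => [_|pn0] XY YZ.
  rewrite EFinD; apply: le_lt_trans (lteD XY YZ).
  apply: (@le_trans _ _ (P ([set w | e1 <= `|X w - Y w|] `|`
                            [set w | e2 <= `|Y w - Z w|]))).
    apply: le_measure; rewrite ?inE//; first exact: measurableU.
    move=> w /= XZ; apply/orP; rewrite -[_ || _]negbK negb_or -!ltNge.
    apply/negP => /andP[l1 l2]; move: XZ; rewrite leNgt => /negP; apply.
    rewrite -(subrKA (Y w)) (le_lt_trans (ler_normD _ _))//.
    exact: ltrD.
  exact: measureU2.
have pgt : 0 < p by rewrite lt_neqAle eq_sym pn0.
have mpow (U V : Lp) :
    measurable_fun [set: T] (fun w => (`|U w - V w| `^ p)%:E).
  apply/measurable_EFinP/(@measurableT_comp _ _ _ _ _ _ (@powR R ^~ p)) => //.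
  exact: measurableT_comp (mXB U V).
case: ifPn XY YZ => p1 XY YZ.
  rewrite EFinD; apply: le_lt_trans (lteD XY YZ).
  rewrite -ge0_integralD//=.
  apply: ge0_le_integral => //.
    exact: emeasurable_funD.
  move=> w _; rewrite -EFinD lee_fin.
  apply: (@le_trans _ _ ((`|X w - Y w| + `|Y w - Z w|) `^ p)).
    rewrite ge0_ler_powR ?nnegrE ?addr_ge0//.
    by rewrite -(subrKA (Y w)) ler_normD.
  exact: powR_sub.
rewrite EFinD; apply: le_lt_trans (lteD XY YZ).
apply: le_trans (@minkowski_EFin _ _ _ P _ _ p (mXB X Y) (mXB Y Z) _).
  rewrite le_eqVlt; apply/orP; left; apply/eqP; congr Lnorm.
  by apply/funext => w /=; rewrite subrKA.
by rewrite leNgt.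
Qed.

HB.instance Definition _ := hasNbhs.Build Lp (nbhs_ (entourage_ Lp_ball)).

HB.instance Definition _ := @Nbhs_isPseudoMetric.Build R Lp
  (entourage_ Lp_ball) erefl Lp_ball ball_center ball_sym ball_triangle erefl.

Lemma cvg_Lp0P (F : set_system Lp) (FF : Filter F) (X : Lp) : p = 0 ->
  F --> X <->
  (forall e : R, 0 < e ->
    (fun Y : Lp => P [set w | e <= `|X w - Y w|]%R) @ F --> 0%E).
Proof.
move=> p_eq0; have ballE Y e : ball X e Y =
    (P [set w | e <= `|X w - Y w|]%R < e%:E)%E :> Prop.
  by rewrite /ball/= /Lp_ball ifT//; exact/eqP.
split=> [FX e e0|h].
  apply/fine_cvgP; split.
    by apply: nearW => Y; apply: fin_num_measure; exact: mset.
  apply/cvgrPdist_lt => _/posnumP[r].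
  move/cvg_ballP : FX => /(_ (Num.min e r%:num)).
  rewrite lt_min e0/= => /(_ (gt0 r)); apply: filterS => Y; rewrite ballE => PY.
  rewrite sub0r normrN ger0_norm ?fine_ge0// -lte_fin fineK ?fin_num_measure////.
  apply: (@le_lt_trans _ _
      (P [set w | Num.min e r%:num <= `|X w - Y w|]%R)).
    apply: le_measure; rewrite ?inE// => w /= ew.
    by rewrite ge_min ew.
  by apply: lt_le_trans PY _; rewrite lee_fin ge_min lexx orbT.
apply/cvg_ballP => e e0.
have /fine_cvgP[_ /cvgrPdist_lt/(_ e e0)] := h e e0.
apply: filterS => Y; rewrite ballE sub0r normrN ger0_norm ?fine_ge0//.
by rewrite -lte_fin fineK ?fin_num_measure//.
Qed.

End Lp_structure.

Record traded_asset d (T : measurableType d) (R : realType)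
    (P : probability T R) (p : R) (p0 : 0 <= p) := TradedAsset {
  price0 : R ;
  payoff : LpType P p0 ;
  price0_gt0 : 0 < price0 ;
  payoff_ge0 : {ae P, forall w, 0 <= payoff w} ;
  payoff_neq0 : ~ {ae P, forall w, payoff w = 0} }.

(* The events only depend on [X] and [payoff S] up to null sets, and
   [ereal_inf set0 = +oo]. *)
Definition rho_VaR d (T : measurableType d) (R : realType)
    (P : probability T R) (p : R) (p0 : 0 <= p) (alpha : R)
    (S : traded_asset P p0) (X : LpType P p0) : \bar R :=
  ereal_inf [set m%:E | m in [set m : R |
    (P [set w | X w + m / price0 S * payoff S w < 0]%R <= alpha%:E)%E]].

(* The library's [lower_semicontinuous] is a global notion, and it differs from
   this one at the points where [f] takes the value [+oo]. *)
Definition lsc_at (E : topologicalType) (R : realType) (f : E -> \bar R)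
    (x : E) : Prop :=
  forall e : R, 0 < e ->
    exists2 U, nbhs x U & forall y, U y -> (f x - e%:E <= f y)%E.

Definition usc_at (E : topologicalType) (R : realType) (f : E -> \bar R)
    (x : E) : Prop :=
  lsc_at (fun y => - f y)%E x.

Definition econtinuous_at (E : topologicalType) (R : realType)
    (f : E -> \bar R) (x : E) : Prop :=
  lsc_at f x /\ usc_at f x.

(* Main.v *)
(* Write S = (S_0, S_T) and P_0 = P(S_T = 0). As m -> oo the shortfall probability
   P(X + m S_T / S_0 < 0) decreases to P(S_T = 0, X < 0), and as m -> -oo it
   increases at least to 1 - P_0; this gives finiteness under (b). If P_0 >= 1 - alpha
   the level alpha is never exceeded at X = 0. If P_0 >= alpha, take X <= -1 in L^p
   which is unbounded below on a set where S_T is positive and bounded: whatever m,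
   the shortfall event contains {S_T = 0} and a further set of positive measure.
   Upper semicontinuity fails at X = - c 1_A with P(A) = alpha, S_T bounded on A and c
   large: adding to A a set of arbitrarily small positive measure moves the infimum
   from at most 0 to at least 2. *)
Require Import Defs.
From mathcomp Require Import all_boot all_order all_algebra.
From mathcomp Require Import all_classical all_reals all_analysis.
From mathcomp Require Import measurable_realfun.
From mathcomp Require Import lra.

Set Implicit Arguments.
Unset Strict Implicit.
Unset Printing Implicit Defensive.
Import Order.TTheory GRing.Theory Num.Theory.
Import numFieldNormedType.Exports.
Local Open Scope classical_set_scope.
Local Open Scope ring_scope.

(** * Measurability of events defined by inequalities *)

Section measurable_sets.
Context d (T : measurableType d) (R : realType).
Implicit Types f g : T -> R.

Lemma measurable_set_lt f g : measurable_fun setT f -> measurable_fun setT g ->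
  measurable [set w | f w < g w].
Proof.
move=> mf mg; rewrite -[X in measurable X]setTI.
exact: (measurable_fun_ltr mf mg measurableT (Y := [set true])).
Qed.

Lemma measurable_set_le f g : measurable_fun setT f -> measurable_fun setT g ->
  measurable [set w | f w <= g w].
Proof.
by move=> mf mg; rewrite -[X in measurable X]setTI; exact: measurable_fun_le.
Qed.

End measurable_sets.

(** * Real-valued probabilities and nonatomic spaces *)

Definition pr d (T : measurableType d) (R : realType) (P : probability T R)
  (A : set T) : R := fine (P A).

Section probability.
Context d (T : measurableType d) (R : realType) (P : probability T R).
Implicit Types A B D : set T.

(** Elements of $L^p$ are known only up to null sets, so the inclusions of events used later hold
    only almost surely. *)
Lemma ae_le_measure A B : measurable A -> measurable B ->
  {ae P, forall w, A w -> B w} -> (P A <= P B)%E.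
Proof.
move=> mA mB AB; rewrite (measureDI P mA mB).
have AB0 : P (A `\` B) = 0%E.
  apply: measure_negligible; first exact: measurableD.
  by apply: negligibleS AB => w [Aw nBw] /(_ Aw).
by rewrite [X in (X + _)%E]AB0 add0e le_measure ?inE//; exact: measurableI.
Qed.

Local Notation pr := (pr P).

Lemma prE A : measurable A -> P A = (pr A)%:E.
Proof. by move=> mA; rewrite /pr fineK// fin_num_measure. Qed.

Lemma pr_ge0 A : 0 <= pr A.
Proof. by rewrite /pr fine_ge0. Qed.

Lemma le_pr A B : measurable A -> measurable B -> A `<=` B -> pr A <= pr B.
Proof. by move=> mA mB AB; rewrite -lee_fin -!prE// le_measure// inE. Qed.

Lemma prD A B : measurable A -> measurable B -> A `<=` B ->
  pr (B `\` A) = pr B - pr A.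
Proof.
move=> mA mB AB; have mBA := measurableD mB mA.
have : P B = (P (B `\` A) + P A)%E.
  by rewrite (measureDI P mB mA) (setIidr AB).
by rewrite !prE// => -[->]; rewrite addrK.
Qed.

Lemma prU A B : measurable A -> measurable B -> A `&` B = set0 ->
  pr (A `|` B) = pr A + pr B.
Proof.
move=> mA mB AB; have PAB : P (A `|` B) = (P A + P B)%E by exact: measureU.
by move: PAB; rewrite !prE; [case|..] => //; exact: measurableU.
Qed.

Lemma prC A : measurable A -> pr (~` A) = 1 - pr A.
Proof.
move=> mA; have := probability_setC P mA.
by rewrite !prE; [rewrite -EFinB => -[]|..] => //; exact: measurableC.
Qed.

Lemma pr_le1 A : measurable A -> pr A <= 1.
Proof. by move=> mA; rewrite -lee_fin -prE// probability_le1. Qed.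

(** Nonatomicity splits a set of positive measure into two parts of positive measure, one of which
    has at most half the measure; iterating from [A] gets below any [e]. *)
Lemma nonatomic_small_subset A (e : R) : nonatomic P ->
  measurable A -> 0 < pr A -> 0 < e ->
  exists B, [/\ measurable B, B `<=` A, 0 < pr B & pr B < e].
Proof.
move=> hP mA A0 e0.
have [n ne] : exists n, e^-1 < (2 ^ n)%:R.
  exists (Num.bound e^-1); apply: lt_trans (archi_boundP _) _.
    by rewrite invr_ge0 ltW.
  by rewrite ltr_nat ltn_expl.
suff /(_ n)[B [mB BA B0 Bn]] : forall n, exists B,
    [/\ measurable B, B `<=` A, 0 < pr B & pr B * (2 ^ n)%:R <= 1].
  exists B; split => //; rewrite -(ltr_pM2r (_ : 0 < (2 ^ n)%:R)); last first.
    by rewrite ltr0n expn_gt0.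
  by rewrite (le_lt_trans Bn)// mulrC -ltr_pdivrMr// mul1r.
elim=> [|k [B [mB BA B0 Bk]]].
  by exists A; split => //; rewrite mulr1 pr_le1.
have [|C [mC CB]] := hP B mB; first by rewrite prE// lte_fin.
rewrite !prE// !lte_fin => C0 CltB.
have [CB2|CB2] := leP (pr C * 2) (pr B).
  exists C; split => //; first exact: subset_trans BA.
  by rewrite expnS natrM mulrA (le_trans _ Bk)// ler_wpM2r.
exists (B `\` C); split.
- exact: measurableD.
- by apply: subset_trans BA; exact: subDsetl.
- by rewrite prD// subr_gt0.
- rewrite expnS natrM mulrA (le_trans _ Bk)// ler_wpM2r// prD//; lra.
Qed.

(* Sierpinski's theorem, by greedy exhaustion: each step gains at least half of
   what can still be gained below the level [a]. *)
Lemma nonatomic_exact_subset A (a : R) : nonatomic P ->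
  measurable A -> 0 <= a -> a <= pr A ->
  exists B, [/\ measurable B, B `<=` A & pr B = a].
Proof.
move=> hP mA a0 aA.
pose ok B := [/\ measurable B, B `<=` A & pr B <= a].
pose X := {B : set T | ok B}.
have ok0 : ok set0 by split => //; rewrite /pr measure0.
pose next (x y : X) := sval x `<=` sval y /\
  forall D, ok D -> sval x `<=` D ->
    pr D - pr (sval x) <= 2 * (pr (sval y) - pr (sval x)).
have step (x : X) : {y : X | next x y}.
  apply: cid; case: x => B okB; rewrite /next/=.
  pose E := [set pr D | D in [set D | ok D /\ B `<=` D]].
  have EB : E (pr B) by exists B; split=> //; exact: subset_refl.
  have supE : has_sup E.
    split; first by exists (pr B).
    by exists a => _ /= [D [[_ _ Da] _] <-].
  have BE : pr B <= sup E by apply: ub_le_sup => //; case: supE.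
  have DE D : ok D -> B `<=` D -> pr D <= sup E.
    by move=> okD BD; apply: ub_le_sup; [case: supE|exists D].
  (* If the supremum does not exceed [pr B], no extension gains anything and [B] is kept. *)
  have [BltE|EleB] := ltP (pr B) (sup E); last first.
    exists (exist _ B okB); split => //= D okD BD.
    by have := DE D okD BD; lra.
  (* Whatever exceeds the midpoint between [pr B] and the supremum realises at least half of the
     possible gain. *)
  have [|_ [C [okC BC] <-] hC] := @sup_adherent _ E ((sup E - pr B) / 2) _ supE.
    by lra.
  exists (exist _ C okC); split => //= D okD BD.
  by have := DE D okD BD; lra.
have [x [_ xS]] := dependent_choice step (exist _ set0 ok0).
pose B n := sval (x n).
have okB n : ok (B n) := svalP (x n).
have mB n : measurable (B n) by case: (okB n).
pose C := \bigcup_n B n.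
have mC : measurable C by exact: bigcup_measurable.
have CA : C `<=` A by move=> w [n _]; case: (okB n) => _ + _; exact.
have ndB : {homo B : n m / (n <= m)%N >-> (n <= m)%O}.
  apply: homo_leq => //; [by move=> ? ? ?; exact: le_trans|].
  by move=> n; rewrite subsetEset; case: (xS n).
have Ca : pr C <= a.
  rewrite -lee_fin -prE//.
  have /cvg_lim <- // := nondecreasing_cvg_mu (mu := P) mB mC ndB.
  apply: lime_le.
    by apply/cvg_ex; exists (P C); exact: nondecreasing_cvg_mu.
  by apply: nearW => n /=; rewrite prE// lee_fin; case: (okB n).
exists C; split => //; apply/eqP; rewrite eq_le Ca leNgt; apply/negP => Clta.
(* If [pr C < a], some [D] of positive measure outside [C] still fits below the level. It could have
   been added at every step, so every step gained at least half of [pr D], and the total would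
   exceed 1. *)
have [|||D [mD DAC D0 Da]] := @nonatomic_small_subset (A `\` C) (a - pr C) hP.
- exact: measurableD.
- by rewrite prD//; lra.
- by rewrite subr_gt0.
have BC n : B n `<=` C by move=> w Bw; exists n.
have gain n : pr D <= 2 * (pr (B n.+1) - pr (B n)).
  have BD : pr (B n `|` D) = pr (B n) + pr D.
    apply: prU => //; rewrite -subset0 => w [/BC Cw /DAC[_]]; exact.
  have := (xS n).2 (B n `|` D); rewrite BD => /(_ _ _)/=.
  rewrite addrAC subrr add0r; apply; last exact: subsetUl.
  split; first exact: measurableU.
    by move=> w [/BC/CA//|/DAC[]].
  by rewrite BD; have := le_pr (mB n) mC (BC n); lra.
have grow n : n%:R * pr D <= 2 * pr (B n).
  elim: n => [|n IHn]; first by rewrite mul0r mulr_ge0 ?pr_ge0.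
  by have := gain n; rewrite -natr1; lra.
have := archi_boundP (_ : 0 <= 2 / pr D).
rewrite divr_ge0 ?ltW// => /(_ isT); rewrite ltr_pdivrMr// => h.
have := grow (Num.bound (2 / pr D)); have := pr_le1 (mB (Num.bound (2 / pr D))).
by lra.
Qed.

(** By the Archimedean property these sets decrease in [n] to the empty set, so continuity from
    above applies. *)
Lemma pr_vanishing (f g : T -> R) (e : R) :
  measurable_fun setT f -> measurable_fun setT g -> 0 < e ->
  exists n : nat, pr ([set w | 0 < f w] `&` [set w | n%:R * f w <= g w]) < e.
Proof.
move=> mf mg e0.
pose F n := [set w | 0 < f w] `&` [set w | n%:R * f w <= g w].
have mF n : measurable (F n).
  apply: measurableI; first exact: measurable_set_lt.
  by apply: measurable_set_le => //; exact: measurable_funM.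
have F0 : \bigcap_n F n = set0.
  rewrite -subset0 => w Fw; have [/= f0 _] := Fw 0%N I.
  have := archi_boundP (_ : 0 <= `|g w| / f w).
  rewrite divr_ge0 ?(ltW f0)// => /(_ isT); rewrite ltr_pdivrMr// ltNge => /negP; apply.
  by have [_ /= /le_trans] := Fw (Num.bound (`|g w| / f w)) I; apply; exact: ler_norm.
have niF : {homo F : n m / (n <= m)%N >-> (m <= n)%O}.
  move=> n m nm; rewrite subsetEset => w [/= f0 fg]; split => //=.
  by apply: le_trans fg; rewrite ler_wpM2r ?(ltW f0)// ler_nat.
have : (P \o F) x @[x --> \oo] --> 0%E.
  rewrite -(measure0 P) -F0; apply: nonincreasing_cvg_mu => //.
    suff : (P (F 0%N) < +oo)%E by []; by rewrite prE// ltry.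
  exact: bigcap_measurable.
move=> /fine_cvgP[_ /cvgrPdist_lt/(_ e e0)][n _ /(_ n (leqnn n))]/=.
rewrite sub0r normrN ger0_norm ?pr_ge0// => Fe.
by exists n.
Qed.

End probability.

(** * Construction of elements of $L^p$ and small perturbations *)

Section Lp.
Context d (T : measurableType d) (R : realType) (P : probability T R).
Variables (p : R) (p0 : 0 <= p).
Implicit Types X Y : LpType P p0.

Lemma measurable_Lp X : measurable_fun [set: T] X.
Proof. exact: (@measurable_funPT _ _ _ _ (repr (Lp_class X))). Qed.

Lemma measurable_powR_norm (f : T -> R) : measurable_fun [set: T] f ->
  measurable_fun [set: T] (fun w => (`|f w| `^ p)%:E).
Proof.
move=> mf; apply/measurable_EFinP/(@measurableT_comp _ _ _ _ _ _ (@powR R ^~ p)) => //.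
exact: measurableT_comp.
Qed.

(** The representative chosen from the class of [f] need not be [f] itself, hence equality only
    almost everywhere. *)
Lemma Lp_of_fun (f : T -> R) : measurable_fun [set: T] f ->
  p = 0 \/ (\int[P]_w (`|f w| `^ p)%:E < +oo)%E ->
  exists X, {ae P, forall w, X w = f w}.
Proof.
move=> mf hf.
pose F : {mfun T >-> measurableTypeR R} := @mfun_Sub _ _ T (measurableTypeR R) f (mem_set mf).
pose c : {mfun_ P, T >-> measurableTypeR R} := (\pi F)%qT.
have cf : {ae P, forall w, (repr c : T -> R) w = f w}.
  have : (repr c == F %[mod {mfun_ P, T >-> measurableTypeR R}])%qT.
    by rewrite reprK.
  by rewrite eqmodE => /asboolP; apply: filterS => w; apply.
have cP : (p == 0) || `[< finite_norm P p%:E c >].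
  case: hf => [->|hf]; first by rewrite eqxx.
  apply/orP; right; apply/asboolP; rewrite /finite_norm unlock /=.
  apply: poweR_lty; apply: le_lt_trans hf.
  have mc : measurable_fun [set: T] (repr c).
    exact: (@measurable_funPT _ _ _ _ (repr c)).
  rewrite le_eqVlt; apply/orP; left; apply/eqP.
  apply: ge0_ae_eq_integral => //; do ?exact: measurable_powR_norm.
  rewrite /ae_eq; near=> w => _; congr (`|_| `^ _)%:E.
  by near: w; exact: cf.
by exists (MkLp p0 cP).
Unshelve. all: by end_near. Qed.

Lemma Lp_scale_indic (c : R) (A : set T) : measurable A ->
  exists X, {ae P, forall w, X w = c * \1_A w}.
Proof.
move=> mA; apply: Lp_of_fun; first exact: measurable_funM.
right; apply: (@le_lt_trans _ _ (\int[P]_w (cst (`|c| `^ p)%:E w))%E).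
  apply: ge0_le_integral => //.
  - by apply: measurable_powR_norm; exact: measurable_funM.
  - move=> w _ /=; rewrite lee_fin ge0_ler_powR ?nnegrE//.
    by rewrite normrM ler_piMr// ger0_norm// indicE; case: (_ \in _).
by rewrite integral_cst// [X in (_ * X)%E]probability_setT mule1 ltry.
Qed.

(** A change of size at most [M] on a set of small probability is small in each of the three
    topologies, with [r] independent of [X], [Y] and [B]. *)
Lemma Lp_ball_indic (M e : R) : 0 <= M -> 0 < e ->
  exists2 r, 0 < r & forall X Y (B : set T), measurable B ->
    {ae P, forall w, `|X w - Y w| <= M * \1_B w} ->
    pr P B < r -> ball X e Y.
Proof.
move=> M0 e0; rewrite /ball/= /Lp_ball; case: (eqVneq p 0) => [_|pn0].
  (* For [p = 0], almost surely $|X - Y| \ge e$ happens only on [B], so [r = e] will do. *)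
  exists e => // X Y B mB XY Be; rewrite -lte_fin in Be.
  apply: le_lt_trans Be; rewrite -prE//; apply: ae_le_measure => //.
    by apply: measurable_set_le => //; apply: measurableT_comp => //;
      apply: measurable_funB; exact: measurable_Lp.
  apply: filterS XY => w XYw /= eXY; rewrite -[B w]in_setE.
  apply: contraLR (le_trans eXY XYw) => nB.
  by rewrite indicE (negbTE nB) mulr0 -ltNge.
have int_bound X Y B : measurable B ->
    {ae P, forall w, `|X w - Y w| <= M * \1_B w} ->
    (\int[P]_w (`|X w - Y w| `^ p)%:E <= (M `^ p * pr P B)%:E)%E.
  move=> mB XY; rewrite EFinM -prE//.
  rewrite -[X in (_ <= _ * P X)%E]setIT -integral_indic//.
  rewrite -ge0_integralZl//; last first.
  - by rewrite lee_fin powR_ge0.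
  - by apply/measurable_EFinP.
  apply: ae_ge0_le_integral => //.
  - by apply: measurable_powR_norm; apply: measurable_funB; exact: measurable_Lp.
  - by move=> w _; rewrite -EFinM lee_fin mulr_ge0// powR_ge0.
  - by apply/measurable_EFinP; exact: measurable_funM.
  - apply: filterS XY => w XYw _; rewrite -EFinM lee_fin.
    apply: (@le_trans _ _ ((M * \1_B w) `^ p)).
      by rewrite ge0_ler_powR ?nnegrE ?mulr_ge0.
    (* Off [B] the bound is $0^p$, which vanishes because $p \ne 0$ in this branch. *)
    by rewrite indicE; case: (_ \in _); rewrite ?mulr1// !mulr0 powR0.
have bound X Y B (eta : R) : 0 < eta -> measurable B ->
    {ae P, forall w, `|X w - Y w| <= M * \1_B w} ->
    pr P B < eta / (M `^ p + 1) ->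
    (\int[P]_w (`|X w - Y w| `^ p)%:E < eta%:E)%E.
  move=> eta0 mB /(int_bound _ _ _ mB) XY; have Mp := powR_ge0 M p.
  rewrite ltr_pdivlMr; last by lra.
  move=> Bx; apply: le_lt_trans XY _; rewrite lte_fin.
  by have := pr_ge0 P B; lra.
case: (ltP p 1) => p1.
  (* The summand [1] keeps the denominator positive even if [M = 0]. *)
  exists (e / (M `^ p + 1)); first by rewrite divr_gt0// ltr_wpDl ?powR_ge0.
  by move=> X Y B mB XY Be; exact: bound XY Be.
have pgt : 0 < p by rewrite lt_neqAle eq_sym pn0.
(* The norm is below [e] once the integral of $|X - Y|^p$ is below $e^p$. *)
exists (e `^ p / (M `^ p + 1)).
  by rewrite divr_gt0 ?powR_gt0// ltr_wpDl ?powR_ge0.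
move=> X Y B mB XY Be.
have /(_ (powR_gt0 _ e0)) := bound X Y B _ _ mB XY Be.
have NE : (\int[P]_w (`|X w - Y w| `^ p)%:E)%E =
    ('N[P]_p%:E [EFin \o (fun w => X w - Y w)%R] `^ p)%E.
  by rewrite poweR_Lnorm//; under [RHS]eq_integral do rewrite /= poweR_EFin.
rewrite NE; apply: contraTT; rewrite -!leNgt -poweR_EFin.
by apply: gt0_ler_poweR; rewrite ?in_itv/= ?lee_fin ?leey ?(ltW pgt) ?(ltW e0)// ?Lnorm_ge0.
Qed.

End Lp.

(** * Shortfall events and bounds on the risk measure *)

Section VaR.
Context d (T : measurableType d) (R : realType) (P : probability T R).
Variables (hP : nonatomic P) (p : R) (p0 : 0 <= p).
Variable alpha : R.
Implicit Types (S : traded_asset P p0) (X Y : LpType P p0).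

Definition shortfall S X (m : R) : set T :=
  [set w | X w + m / price0 S * payoff S w < 0].

Lemma measurable_shortfall S X m : measurable (shortfall S X m).
Proof.
apply: measurable_set_lt => //; apply: measurable_funD; first exact: measurable_Lp.
by apply: measurable_funM => //; exact: measurable_Lp.
Qed.

Lemma ge_rho_VaR S X (m : R) : pr P (shortfall S X m) <= alpha ->
  (rho_VaR alpha S X <= m%:E)%E.
Proof.
move=> h; apply: ge_ereal_inf; exists m%:E => //; exists m => //=.
by rewrite -[X in (X <= _)%E]/(P (shortfall S X m)) prE ?lee_fin//;
  exact: measurable_shortfall.
Qed.

Lemma le_rho_VaR S X (r : R) :
  (forall m, pr P (shortfall S X m) <= alpha -> r <= m) ->
  (r%:E <= rho_VaR alpha S X)%E.
Proof.
move=> h; apply/ereal_infP => _ [m /= hm <-]; rewrite lee_fin h//.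
rewrite -lee_fin -prE//; exact: measurable_shortfall.
Qed.

Lemma rho_VaR_pinfty S X : (forall m, alpha < pr P (shortfall S X m)) ->
  rho_VaR alpha S X = +oo%E.
Proof.
move=> h; apply/eqP; rewrite -leye_eq; apply/ereal_infP => _ [m /= hm <-].
have := h m; rewrite ltNge -lee_fin -prE ?hm//; exact: measurable_shortfall.
Qed.

Lemma measurable_payoff0 S : measurable [set w | payoff S w = 0].
Proof.
rewrite -[X in measurable X]setTI.
exact: (measurable_Lp (payoff S) measurableT (Y := [set 0])).
Qed.

Lemma measurable_payoff_gt0 S : measurable [set w | 0 < payoff S w].
Proof. by apply: measurable_set_lt => //; exact: measurable_Lp. Qed.

(** The payoff is nonnegative only almost surely, so the two events are complementary up to a null
    set. *)
Lemma pr_payoff_gt0 S :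
  pr P [set w | 0 < payoff S w] = 1 - pr P [set w | payoff S w = 0].
Proof.
have mZ := measurable_payoff0 S; have mS := measurable_payoff_gt0 S.
rewrite -prC//; apply/eqP; rewrite eq_le -!lee_fin -!prE//; last exact: measurableC.
apply/andP; split; apply: ae_le_measure => //; do ?exact: measurableC.
  by apply: aeW => w /= + S0; rewrite S0 ltxx.
by apply: filterS (payoff_ge0 S) => w S0 /eqP Sn0; rewrite /= lt_neqAle eq_sym Sn0.
Qed.

Lemma pr_payoff_lt S (e : R) : 0 < e ->
  exists n : nat, 1 - e < pr P [set w | payoff S w < n%:R].
Proof.
move=> e0; have mS := measurable_Lp (payoff S).
(* With $f = 1$ the vanishing events are $\{n \le S_T\}$. *)
have [n hn] := pr_vanishing P (measurable_cst (1 : R)) mS e0; exists n; move: hn.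
have mD : measurable [set w | payoff S w < n%:R] by exact: measurable_set_lt.
set E := _ `&` _; have -> : E = ~` [set w | payoff S w < n%:R]; last first.
  by rewrite prC//; lra.
apply/seteqP; split => w; rewrite /E/= mulr1 leNgt; first by case=> _ /negP.
by move=> /negP Sn; split.
Qed.

(** * Failure of upper semicontinuity *)

Lemma rho_VaR_not_usc S : 0 < alpha -> alpha < 1 ->
  exists X, ~ usc_at (rho_VaR alpha S) X.
Proof.
move=> alpha0 alpha1; have s0 := price0_gt0 S.
(* The tolerance makes the probability of [D] strictly larger than [alpha], which leaves room for
   [B] in [D] outside [A]. *)
have [|n hn] := @pr_payoff_lt S (1 - alpha); first by lra.
set D := [set w | payoff S w < n%:R] in hn.
have mD : measurable D by apply: measurable_set_lt => //; exact: measurable_Lp.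
have [|A [mA AD Aalpha]] := nonatomic_exact_subset hP mD (ltW alpha0).
  by lra.
(* For [m < 2] the asset contributes almost surely at most $2n/S_0 < c$ on [D], so a loss of [c]
   there is not covered. *)
pose c : R := 2 / price0 S * n%:R + 1.
have c0 : 0 < c by rewrite ltr_wpDl// mulr_ge0// divr_ge0// ltW.
have [X Xc] := Lp_scale_indic P p0 (- c) mA; exists X => /(_ 1 ltr01)[U XU hU].
have /nbhs_ballP[e /= e0 eU] := XU.
have [r r0 hr] := Lp_ball_indic P p0 (ltW c0) e0.
have [|B [mB BDA B0 Br]] := nonatomic_small_subset hP (measurableD mD mA) _ r0.
  by rewrite prD//; lra.
have mAB : measurable (A `|` B) by exact: measurableU.
have [Y Yc] := Lp_scale_indic P p0 (- c) mAB.
(* At [m = 0] the shortfall lies almost surely in [A], whose probability is exactly [alpha]. *)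
have rhoX : (rho_VaR alpha S X <= 0)%E.
  apply: ge_rho_VaR; rewrite -Aalpha -lee_fin -!prE//; last exact: measurable_shortfall.
  apply: ae_le_measure => //; first exact: measurable_shortfall.
  apply: filterS Xc => w Xw; rewrite /shortfall/= Xw !mul0r addr0 indicE.
  by case: (boolP (w \in A)) => [/set_mem//|_]; rewrite mulr0 ltxx.
have rhoY : (2%:E <= rho_VaR alpha S Y)%E.
  apply: le_rho_VaR => m hm; rewrite leNgt; apply/negP => m2.
  have : pr P (A `|` B) <= pr P (shortfall S Y m).
    have mY := measurable_shortfall S Y m.
    rewrite -lee_fin -!prE//; apply: ae_le_measure => //.
    apply: filterS2 Yc (payoff_ge0 S) => w Yw Sw ABw.
    have Swn : payoff S w < n%:R by case: ABw => [/AD//|/BDA[]].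
    rewrite /shortfall/= Yw indicE mem_set//= mulr1.
    have : m / price0 S * payoff S w <= 2 / price0 S * n%:R.
      apply: (@le_trans _ _ (2 / price0 S * payoff S w)).
        by rewrite ler_wpM2r// ler_wpM2r ?invr_ge0// ltW.
      by rewrite ler_wpM2l ?divr_ge0// ltW.
    by rewrite /c; lra.
  rewrite prU//; first by lra.
  by rewrite -subset0 => w [Aw /BDA[]].
have /hU : U Y.
  apply: eU; apply: hr mB _ Br; apply: filterS2 Xc Yc => w -> ->.
  have : B w -> ~ A w by move=> /BDA[].
  rewrite !indicE in_setU; case: (boolP (w \in A)) => [/set_mem Aw|_];
    case: (boolP (w \in B)) => [/set_mem Bw|_] //= h; first by case: (h Bw).
  - by rewrite subrr normr0 mulr0.
  - by rewrite mulr0 sub0r mulr1 opprK mulr1 ger0_norm// ltW.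
  - by rewrite !mulr0 subrr normr0.
(* Upper semicontinuity with tolerance 1 would give $-\rho(X) - 1 \le -\rho(Y)$, whereas $-\rho(Y)
   \le -2 < -1 \le -\rho(X) - 1$. *)
apply/negP; rewrite -ltNge; apply: (@le_lt_trans _ _ (- 2%:E)%E).
  by rewrite leeN2.
apply: (@lt_le_trans _ _ (0 - 1)%E).
  by rewrite sub0e -!EFinN lte_fin; lra.
by rewrite leeD2r// oppe_ge0.
Qed.

(** * Finiteness when the payoff rarely vanishes *)

Lemma rho_VaR_fin_num S X :
  pr P [set w | payoff S w = 0] < Num.min alpha (1 - alpha) ->
  rho_VaR alpha S X \is a fin_num.
Proof.
set Z := [set w | _] => Zmin; have s0 := price0_gt0 S.
have mZ : measurable Z := measurable_payoff0 S.
have mS := measurable_Lp (payoff S).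
(* This slack will bound the probability of [F], the event that $S_T > 0$ and $n S_T / S_0 \le
   |X|$. *)
have : 0 < Num.min alpha (1 - alpha) - pr P Z by lra.
have mf : measurable_fun [set: T] (fun w => (price0 S)^-1 * payoff S w).
  exact: measurable_funM.
have mg : measurable_fun [set: T] (fun w => `|X w|).
  by apply: measurableT_comp => //; exact: measurable_Lp.
move=> /(pr_vanishing P mf mg)[n]; set F := _ `&` _ => hF.
have mF : measurable F.
  apply: measurableI; first exact: measurable_set_lt.
  by apply: measurable_set_le => //; exact: measurable_funM.
have [ha hb] : pr P Z + pr P F < alpha /\ pr P Z + pr P F < 1 - alpha.
  by apply/andP; rewrite -lt_min; lra.
have prUle A B : measurable A -> measurable B -> pr P (A `|` B) <= pr P A + pr P B.
  move=> mA mB; rewrite -lee_fin EFinD -!prE//; last exact: measurableU.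
  exact: measureU2.
(* With [m = n] a shortfall occurs almost surely only on [Z] or [F]. *)
have rho_lt : (rho_VaR alpha S X <= n%:R%:E)%E.
  have mX := measurable_shortfall S X n%:R.
  apply: ge_rho_VaR; apply: (@le_trans _ _ (pr P (Z `|` F))); last first.
    by rewrite (le_trans (prUle _ _ mZ mF))// ltW.
  rewrite -lee_fin -!prE//; last exact: measurableU.
  apply: ae_le_measure => //; first exact: measurableU.
  apply: filterS (payoff_ge0 S) => w; rewrite le_eqVlt => /orP[/eqP S0 _|Sw].
    by left; exact/esym.
  rewrite /shortfall/= => Xw; right; split => /=; first by rewrite mulr_gt0 ?invr_gt0.
  by rewrite mulrA -normrN (le_trans _ (ler_norm _))//; lra.
(* For [m < -n] all of $\{S_T > 0\}$ outside [F] is in shortfall, an event of probability at least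
   $1 - P(Z) - P(F) > \alpha$. *)
have rho_gt : ((- n%:R)%:E <= rho_VaR alpha S X)%E.
  apply: le_rho_VaR => m hm; rewrite leNgt; apply/negP => mn.
  have mX := measurable_shortfall S X m; have mU := measurableU _ _ mX mF.
  have : pr P [set w | 0 < payoff S w] <= pr P (shortfall S X m `|` F).
    have mSp := measurable_payoff_gt0 S.
    rewrite -lee_fin -!prE//; apply: le_measure; rewrite ?inE// => w /= Sw.
    have Sw0 : 0 < (price0 S)^-1 * payoff S w by rewrite mulr_gt0 ?invr_gt0.
    have [XF|XF] := leP (n%:R * ((price0 S)^-1 * payoff S w)) `|X w|; first by right.
    left; rewrite /shortfall/= -mulrA.
    have := ler_norm (X w); have : m * ((price0 S)^-1 * payoff S w) <=
      - n%:R * ((price0 S)^-1 * payoff S w) by rewrite ler_wpM2r ?ltW.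
    lra.
  by have := prUle _ _ mX mF; rewrite pr_payoff_gt0 -/Z; lra.
by rewrite fin_real// (lt_le_trans (ltNyr _) rho_gt) (le_lt_trans rho_lt (ltry _)).
Qed.

(** * Infinite values when the payoff vanishes too often *)

Lemma rho_VaR_ninfty S : 1 - alpha <= pr P [set w | payoff S w = 0] ->
  exists X, rho_VaR alpha S X \isn't a fin_num.
Proof.
(* At $X = 0$ a shortfall requires $S_T \ne 0$, whatever [m] is, so every real [m] is admissible. *)
move=> Zalpha; have [X X0] := Lp_scale_indic P p0 0 measurableT; exists X.
have h m : (rho_VaR alpha S X <= m%:E)%E.
  apply: ge_rho_VaR; apply: (@le_trans _ _ (pr P (~` [set w | payoff S w = 0]))).
    have mX := measurable_shortfall S X m.
    have mZ := measurableC (measurable_payoff0 S).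
    rewrite -lee_fin -!prE//; apply: ae_le_measure => //.
    by apply: filterS X0 => w Xw; rewrite /shortfall/= Xw => + S0;
      rewrite S0 mul0r mulr0 addr0 ltxx.
  by rewrite prC; [lra|exact: measurable_payoff0].
apply/negP => /fineK rhoE; have := h (fine (rho_VaR alpha S X) - 1).
by rewrite -[X in (X <= _)%E]rhoE lee_fin; lra.
Qed.

(* [X = - (1 + h) ^ (1 / (1 + p))] with [h = \sum_n n 1_(B n)] integrable and [B n]
   of positive measure; the exponent makes [|X| ^ p <= 1 + h] for every [p >= 0]. *)
Lemma Lp_essentially_unbounded (D : set T) : measurable D -> 0 < pr P D ->
  exists X, {ae P, forall w, X w <= -1} /\ forall n : nat, exists B : set T,
    [/\ measurable B, B `<=` D, 0 < pr P B & {ae P, forall w, B w -> X w < - n%:R}].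
Proof.
move=> mD D0.
(* This decay gives $\sum_n n P(B_n) \le \sum_n 2^{-(n+1)} = 1$. *)
have [B hB] : {B : nat -> set T & forall n, [/\ measurable (B n), B n `<=` D,
    0 < pr P (B n) & pr P (B n) < (n.+1%:R * (2 ^ n.+1)%:R)^-1]}.
  apply: (@choice _ _ (fun n B => [/\ measurable B, B `<=` D, 0 < pr P B &
    pr P B < (n.+1%:R * (2 ^ n.+1)%:R)^-1])) => n.
  apply: (nonatomic_small_subset hP mD D0).
  by rewrite invr_gt0 mulr_gt0// ltr0n expn_gt0.
have mB n : measurable (B n) by case: (hB n).
pose u n w : \bar R := (n%:R * \1_(B n) w)%:E.
have u0 n w : (0 <= u n w)%E by rewrite lee_fin mulr_ge0.
have mu n : measurable_fun [set: T] (u n).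
  by apply/measurable_EFinP; exact: measurable_funM.
pose F w := (\sum_(0 <= n <oo) u n w)%E.
have F0 w : (0 <= F w)%E by apply: nneseries_ge0 => n _ _; exact: u0.
have mF : measurable_fun [set: T] F.
  by apply: ge0_emeasurable_sum => // k w _ _; exact: u0.
have intF : (\int[P]_w F w <= 1)%E.
  rewrite integral_nneseries//.
  apply: (@le_trans _ _ (\sum_(0 <= n <oo) (0 + (1 / (2 ^ n.+1)%:R)%:E))%E).
    apply: lee_nneseries => n _; first by move=> _; exact: integral_ge0.
    rewrite add0e (_ : (fun w => _) = fun w => (n%:R%:E * (\1_(B n) w)%:E)%E)//.
    rewrite ge0_integralZl//; last exact/measurable_EFinP.
    rewrite integral_indic// setIT -[X in (_ * X <= _)%E]/(P (B n)) prE// -EFinM lee_fin.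
    have [_ _ _ /ltW Bn] := hB n.
    apply: (@le_trans _ _ (n.+1%:R * (n.+1%:R * (2 ^ n.+1)%:R)^-1)).
      by apply: ler_pM => //; rewrite ?pr_ge0// ler_nat.
    by rewrite invfM mulrA divff// mul1r div1r.
  apply: le_trans (epsilon_trick xpredT _ _) _ => //.
  by rewrite eseries0// add0e.
have Ffin : {ae P, forall w, F w \is a fin_num}.
  have : P.-integrable setT F.
    apply/integrableP; split => //.
    under eq_integral do rewrite gee0_abs//.
    by rewrite (le_lt_trans intF)// ltry.
  by move=> /(integrable_ae measurableT); apply: filterS => w; apply.
pose h w := fine (F w).
have h0 w : 0 <= h w by rewrite fine_ge0.
have h1 w : 1 <= 1 + h w by rewrite lerDl.
have mh : measurable_fun [set: T] h by exact: measurableT_comp.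
pose q := (1 + p)^-1.
have p1 : 0 < 1 + p by rewrite ltr_wpDr.
have q0 : 0 < q by rewrite invr_gt0.
have mf : measurable_fun [set: T] (fun w => - (1 + h w) `^ q).
  apply: measurableT_comp => //; apply: (measurableT_comp (measurable_powR q)).
  exact: measurable_funD.
have fp : (\int[P]_w (`|- (1 + h w) `^ q| `^ p)%:E < +oo)%E.
  apply: (@le_lt_trans _ _ (\int[P]_w (1 + F w))%E); last first.
    rewrite ge0_integralD// integral_cst// [X in (_ * X)%E]probability_setT mule1.
    by rewrite (le_lt_trans (leeD2l _ intF))// -EFinD ltry.
  apply: ge0_le_integral => //; first exact: measurable_powR_norm.
    exact: emeasurable_funD.
  move=> w _; apply: (@le_trans _ _ (1 + h w)%:E).
    rewrite lee_fin normrN ger0_norm ?powR_ge0// -powRrM.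
    rewrite -[leRHS]powRr1 ?addr_ge0// ler_powR//.
    by rewrite /q mulrC ler_pdivrMr; lra.
  (* [fine] sends [+oo] to 0, so [h] is at most [F] everywhere. *)
  rewrite EFinD leeD2l// /h; case: (F w) (F0 w) => //= _; exact: leey.
have [X Xh] := Lp_of_fun p0 mf (or_intror fp).
exists X; split.
  apply: filterS Xh => w ->; rewrite lerN2 [leLHS](_ : 1 = 1 `^ q); last by rewrite powR1.
  by rewrite ge0_ler_powR ?nnegrE ?addr_ge0// ltW.
(* [k] exceeds $n^{1+p}$ and $h \ge k$ almost surely on [B k], so $(1 + h)^{1/(1+p)} > n$ there. *)
move=> n; pose k := Num.bound (n%:R `^ (1 + p) : R).
have [_ BD B0 _] := hB k; exists (B k); split => //.
apply: filterS2 Xh Ffin => w -> Fw Bw; rewrite ltrN2.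
have nk : n%:R `^ (1 + p) < 1 + h w.
  apply: lt_le_trans (archi_boundP (powR_ge0 _ _)) _.
  rewrite (@le_trans _ _ (h w)) ?lerDr// -lee_fin /h fineK//.
  (* The partial sum stops at [k.+1] so as to include the term of index [k]. *)
  apply: le_trans (nneseries_lim_ge k.+1 _); last by move=> *; exact: u0.
  rewrite big_nat_recr//= -[leLHS]add0e leeD ?sume_ge0//.
  by rewrite /u indicE mem_set// mulr1.
have -> : n%:R = (n%:R `^ (1 + p)) `^ q :> R.
  by rewrite -powRrM divff ?powRr1//; lra.
by rewrite gt0_ltr_powR ?nnegrE ?powR_ge0 ?addr_ge0.
Qed.

Lemma rho_VaR_pinfty_ex S : alpha <= pr P [set w | payoff S w = 0] ->
  exists X, rho_VaR alpha S X = +oo%E.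
Proof.
set Z := [set w | _] => Zalpha; have s0 := price0_gt0 S.
have mZ : measurable Z := measurable_payoff0 S.
have mSp := measurable_payoff_gt0 S.
have Z1 : 0 < 1 - pr P Z.
  rewrite lt_neqAle subr_ge0 pr_le1// andbT; apply/eqP => Z1.
  apply: (@payoff_neq0 _ _ _ _ _ _ S).
  apply: (@negligibleS _ _ _ P (~` Z)) => //; apply/negligibleP; first exact: measurableC.
  by rewrite -[LHS]/(P (~` Z)) prE ?prC -?Z1//; exact: measurableC.
(* With this tolerance [E] has probability larger than $P(Z)$, so it meets the complement of [Z] in
   positive probability. *)
have [n hn] := pr_payoff_lt S Z1.
set E := [set w | payoff S w < n%:R] in hn.
have mE : measurable E by apply: measurable_set_lt => //; exact: measurable_Lp.
have D0 : 0 < pr P (E `\` Z).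
  have : pr P E <= pr P ((E `\` Z) `|` Z).
    apply: le_pr => //; first by apply: measurableU => //; exact: measurableD.
    by move=> w Ew; have [Zw|Zw] := pselect (Z w); [right|left].
  rewrite prU//; [lra|exact: measurableD|by rewrite setDKI].
have [X [X1 XB]] := Lp_essentially_unbounded (measurableD mE mZ) D0.
exists X; apply: rho_VaR_pinfty => m.
(* On [B], where $S_T < n$, the asset contributes at most $|m| n / S_0$, and [X] lies below minus an
   integer exceeding that. So [B] adds positive probability to the shortfall on [Z]. *)
have [B [mB BD B0 XBn]] := XB (Num.bound (`|m| / price0 S * n%:R)).
have mX := measurable_shortfall S X m.
have : pr P (Z `|` B) <= pr P (shortfall S X m).
  rewrite -lee_fin -!prE//; last exact: measurableU.
  apply: ae_le_measure => //; first exact: measurableU.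
  apply: filterS3 X1 XBn (payoff_ge0 S) => w Xw XBw Sw [Zw|Bw]; rewrite /shortfall/=.
    by rewrite Zw mulr0 addr0 (le_lt_trans Xw).
  have [/ltW Ew _] := BD w Bw; have {}XBw := XBw Bw.
  have := archi_boundP (_ : 0 <= `|m| / price0 S * n%:R).
  rewrite mulr_ge0 ?divr_ge0 ?(ltW s0)// => /(_ isT).
  have : m / price0 S * payoff S w <= `|m| / price0 S * n%:R; last by lra.
  apply: (@le_trans _ _ (`|m| / price0 S * payoff S w)).
    by rewrite ler_wpM2r// ler_wpM2r ?invr_ge0 ?ler_norm// ltW.
  by rewrite ler_wpM2l ?divr_ge0// ltW.
rewrite prU//; first by lra.
by rewrite -subset0 => w [Zw /BD[_]].
Qed.

End VaR.

(** * Characterisation of finiteness, and absence of global continuity *)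

Theorem proposition4p2 (d : measure_display) (T : measurableType d)
    (R : realType) (P : probability T R) (hP : nonatomic P)
    (p : R) (p0 : 0 <= p) (alpha : R) (halpha0 : 0 < alpha) (halpha1 : alpha < 1) :
  (forall S : traded_asset P p0,
     (forall X : LpType P p0, rho_VaR alpha S X \is a fin_num) <->
     (P [set w | payoff S w = 0]%R < (Num.min alpha (1 - alpha))%:E)%E) /\
  (forall S : traded_asset P p0,
     ~ forall X : LpType P p0, econtinuous_at (rho_VaR alpha S) X).
Proof.
split=> S; last first.
  have [X nX] := rho_VaR_not_usc hP S halpha0 halpha1.
  by move=> /(_ X)[_ /nX].
rewrite prE; last exact: measurable_payoff0.
rewrite lte_fin; split=> [fin|Smin X]; last exact: rho_VaR_fin_num.
rewrite ltNge; apply/negP; rewrite ge_min => /orP[Z|Z].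
  have [X rhoX] := rho_VaR_pinfty_ex hP Z.
  by have := fin X; rewrite rhoX.
by have [X /negP] := rho_VaR_ninfty Z; apply.
Qed.
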